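(* Let $n\geq3$. There do not exist two-times continuously differentiable functions $\Psi\colon[0,\infty)\to\mathbb{R}$ and $W_{\mathrm{vol}}\colon[0,\infty)\to\mathbb{R}$ with $\Psi'(0)>0$ such that the function $$W(F)=\Psi(\|\mathrm{dev}_n\log V\|^2)+W_{\mathrm{vol}}(\det F),\qquad V=\sqrt{FF^T},$$ is rank-one convex on $\mathrm{GL}^+(n)$.
   Context: $\mathrm{GL}^+(n)$ is the group of real $n\times n$ matrices with positive determinant. For $F\in\mathrm{GL}^+(n)$, $V=\sqrt{FF^T}$ is the positive definite symmetric square root of $FF^T$, $\log V$ is its principal matrix logarithm, $\mathrm{dev}_nX=X-\frac1n\,\mathrm{tr}(X)\,\mathrm{Id}$ is the deviatoric (trace-free) part of $X\in\mathbb{R}^{n\times n}$ (with $\mathrm{Id}$ the identity matrix), and $\|X\|^2=\mathrm{tr}(XX^T)$ is the squared Frobenius norm. For $\xi,\eta\in\mathbb{R}^n$, $(\xi\otimes\eta)_{ij}=\xi_i\eta_j$. A function $W\colon\mathrm{GL}^+(n)\to\mathbb{R}$ is called rank-one convex if for all $F\in\mathrm{GL}^+(n)$, all $\xi,\eta\in\mathbb{R}^n$ and any interval $I\subset\mathbb{R}$ such that $\det(F+t\,\xi\otimes\eta)>0$ for all $t\in I$, the mapping $I\to\mathbb{R}$, $t\mapsto W(F+t\,\xi\otimes\eta)$ is convex. *)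

(* Defs.v *)
From HB Require Import structures.
From mathcomp Require Import all_boot all_order all_algebra.
From mathcomp Require Import all_classical all_reals all_analysis.
From mathcomp Require Import complex.

Set Implicit Arguments.
Unset Strict Implicit.
Unset Printing Implicit Defensive.

Import Order.TTheory GRing.Theory Num.Theory.
Import numFieldNormedType.Exports.

Local Open Scope classical_set_scope.
Local Open Scope ring_scope.

(* Differentiation relative to a set D, so one-sided at an end point of an
   interval D. Only the values of f on D matter (for x in D): a function
   D -> R is represented by any of its extensions to R. *)
Definition derivable_within (R : realType) (D : set R) (f : R -> R) (x : R) :=
  cvg ((f y - f x) / (y - x) @[y --> within D x^']).

Definition derive_within (R : realType) (D : set R) (f : R -> R) (x : R) : R :=
  lim ((f y - f x) / (y - x) @[y --> within D x^']).

Definition C2_on (R : realType) (D : set R) (f : R -> R) :=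
  [/\ forall x, D x -> derivable_within D f x,
      forall x, D x -> derivable_within D (derive_within D f) x &
      {within D, continuous (derive_within D (derive_within D f))}].

Definition GLpos (R : realType) (n : nat) : set 'M[R]_n :=
  [set F | 0 < \det F].

Definition posdefmx (R : realType) (n : nat) (A : 'M[R]_n) :=
  forall x : 'cV[R]_n, x != 0 -> 0 < (x^T *m A *m x) 0 0.

(* The default value 0 of xget is taken only if A is not symmetric positive
   definite; otherwise the set below is a singleton. *)
Definition sqrtmx (R : realType) (n : nat) (A : 'M[R]_n) : 'M[R]_n :=
  xget 0 [set V | [/\ V^T = V, posdefmx V & V *m V = A]].

Definition expmx (R : realType) (n : nat) (X : 'M[R]_n) : 'M[R]_n :=
  limn (series (fun k => k`!%:R^-1 *: X ^+ k)).

(* The principal logarithm of a matrix V without eigenvalues in ]-oo, 0] is the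
   unique logarithm whose complex eigenvalues all lie in the open strip
   |Im z| < pi; it is real if V is. *)
Definition logmx (R : realType) (n : nat) (V : 'M[R]_n) : 'M[R]_n :=
  xget 0 [set X | expmx X = V /\
    forall z : R[i], eigenvalue (map_mx (real_complex R) X) z ->
      `|complex.Im z| < pi].

Definition devmx (R : realType) (n : nat) (X : 'M[R]_n) : 'M[R]_n :=
  X - (n%:R^-1 * \tr X)%:M.

Definition frobenius_sq (R : realType) (n : nat) (X : 'M[R]_n) : R :=
  \tr (X *m X^T).

Definition tensormx (R : realType) (n : nat) (xi eta : 'cV[R]_n) : 'M[R]_n :=
  \matrix_(i, j) (xi i 0 * eta j 0).

(* Only the values of W on GLpos matter. *)
Definition rank_one_convex (R : realType) (n : nat) (W : 'M[R]_n -> R) :=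
  forall (F : 'M[R]_n) (xi eta : 'cV[R]_n) (I : set R),
    GLpos F -> is_interval I ->
    (forall t, I t -> GLpos (F + t *: tensormx xi eta)) ->
    convex_function (I : set R^o) (fun t : R => W (F + t *: tensormx xi eta)).

(* Main.v *)
Require Import Defs.
From mathcomp Require Import all_boot all_order all_algebra.
From mathcomp Require Import all_classical all_reals all_analysis.
From mathcomp Require Import complex ring lra.

Set Implicit Arguments.
Unset Strict Implicit.
Unset Printing Implicit Defensive.

Import Order.TTheory GRing.Theory Num.Theory.
Import numFieldNormedType.Exports.

Local Open Scope classical_set_scope.
Local Open Scope ring_scope.

(** The argument has three parts.

    1. Monotonicity. Along the shear line [t |-> 1 + t e_1 (x) e_2] the
    determinant is constant, so [Wvol] drops out, and the singular values are
    [exp (+-y)] with [t = exp y - exp (-y)]: there [|dev log V|^2 = 2 y^2] is an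
    even function of [t] that increases with [|t|]. A convex even function is
    nondecreasing on the positive axis, and if it is constant on some interval
    then it is constant down to [0]. The latter is excluded by [Psi'(0) > 0], so
    [Psi] increases strictly on the positive axis ([increasing_of_even_convex]).

    2. Failure of quasi-convexity. Since [Psi] is strictly increasing,
    [|dev log V|^2] cannot be larger at an interior point of a rank-one segment
    of constant determinant than at both ends. But for [3 x 3] matrices of
    determinant [1] such segments exist. On a rank-one line of constant
    determinant both [|F|^2] and [|Cof F|^2] are quadratic in [t], with minima
    at different points in general. Let [p] and [q] be half the logarithms of these
    two numbers. If the three singular values are of different orders of
    magnitude, then [|dev log V|^2] is approximately [2 (p^2 - p q + q^2)]. For
    the line [pivot b d] with [b = d = exp l] and [l] large, the minima are at
    [t = 0] and [t = b d], where [(p, q)] is about [(l, 2 l)] and [(2 l, l)],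
    with value [6 l^2]; half-way both are about [2 l], with value [8 l^2].
    Explicit parameters turn this into an inequality between squares of
    logarithms: [193 / 2 * ln 2 ^ 2] at the ends and more than
    [98 * ln 2 ^ 2] in the middle ([pivot_exists]).

    3. Evaluation of [log V]. Everything is arranged so that [V] has simple
    spectrum. Then a square root or a real logarithm of a matrix commutes with
    it, hence is diagonal in the same basis, and is determined by scalar
    equations ([hencky_sq_sum]). In dimension [n] the [2 x 2] and [3 x 3]
    examples are completed by a constant diagonal block whose entries are
    pairwise distinct and distinct from the singular values in play; such a
    block adds the constant [pad_sq] to [|dev log V|^2] ([hencky_sq_pad]). *)

(** * Sequences of matrices and the matrix exponential *)

Lemma cvg_mx (R : realType) (m n : nat) (u : nat -> 'M[R]_(m, n))
    (M : 'M[R]_(m, n)) :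
  (forall i j, (fun k => u k i j) @ \oo --> M i j) -> u @ \oo --> M.
Proof.
move=> uM A [P /= PM PA].
rewrite /= !nbhs_simpl /=.
have : \forall k \near \oo, forall i j, P i j (u k i j).
  apply: filter_forall => i; apply: filter_forall => j.
  exact: (uM i j (P i j) (PM i j)).
by apply: filterS => k; apply: PA.
Qed.

Lemma cvg_mx_coord (R : realType) (m n : nat) (u : nat -> 'M[R]_(m, n))
    (M : 'M[R]_(m, n)) i j :
  u @ \oo --> M -> (fun k => u k i j) @ \oo --> M i j.
Proof.
by move=> uM; exact: (cvg_comp _ _ uM (@coord_continuous _ _ _ i j M)).
Qed.

Lemma cvg_mulmx (R : realType) (m n p q : nat) (A : 'M[R]_(m, n))
    (B : 'M[R]_(p, q)) (u : nat -> 'M[R]_(n, p)) M :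
  u @ \oo --> M -> (fun k => A *m u k *m B) @ \oo --> A *m M *m B.
Proof.
move=> uM; apply: cvg_mx => i j; rewrite mxE.
under eq_fun do rewrite mxE.
apply: cvg_big => [|l _]; first exact: add_continuous.
apply: cvgM; last exact: cvg_cst.
rewrite mxE; under eq_fun do rewrite mxE.
apply: cvg_big => [|k _]; first exact: add_continuous.
by apply: cvgM; [exact: cvg_cst|exact: cvg_mx_coord].
Qed.

(** [X] commutes with the partial sums of the exponential series, hence with
    their limit; the conventional limit [0] of a divergent sequence commutes
    with [X] too. *)
Lemma comm_expmx (R : realType) (n : nat) (X : 'M[R]_n) :
  comm_mx X (expmx X).
Proof.
rewrite /expmx; set s := series _.
have Xs k : X *m s k = s k *m X.
  rewrite /s /series /= mulmx_sumr mulmx_suml; apply: eq_bigr => i _.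
  by rewrite -scalemxAr -scalemxAl mulmxE -exprS exprSr.
have [cvs|/dvgP->] := pselect (cvgn s).
  have c1 : (fun k => X *m s k) @ \oo --> X *m limn s.
    rewrite -[X *m limn s]mulmx1; under eq_fun do rewrite -[X *m s _]mulmx1.
    exact: cvg_mulmx.
  have c2 : (fun k => X *m s k) @ \oo --> limn s *m X.
    rewrite -[limn s]mul1mx; under eq_fun do rewrite Xs -[s _]mul1mx.
    exact: cvg_mulmx.
  exact: (cvg_unique (@norm_hausdorff _ _) c1 c2).
rewrite [point](_ : _ = 0); first by rewrite /comm_mx mul0mx mulmx0.
by apply/matrixP => i j; rewrite !mxE.
Qed.

(** The matrix with eigenvalues [u i] for the left eigenvectors [row i P]. As
    [u] varies these form a commutative algebra, on which functional calculus is
    entrywise. *)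
Definition diag_in (R : realType) (n : nat) (P : 'M[R]_n) (u : 'I_n -> R) :=
  invmx P *m diag_mx (\row_i u i) *m P.

Section DiagIn.
Context {R : realType} {n : nat} (P : 'M[R]_n) (Pu : P \in unitmx).
Implicit Types u v : 'I_n -> R.

Lemma diag_inM u v :
  diag_in P u *m diag_in P v = diag_in P (fun i => u i * v i).
Proof.
rewrite /diag_in !mulmxA mulmxK// -(mulmxA (invmx P)) mulmx_diag.
by congr (_ *m diag_mx _ *m _); apply/rowP => i; rewrite !mxE.
Qed.

Lemma diag_inD u v : diag_in P u + diag_in P v = diag_in P (fun i => u i + v i).
Proof.
rewrite /diag_in -mulmxDl -mulmxDr -raddfD/=.
by congr (_ *m diag_mx _ *m _); apply/rowP => i; rewrite !mxE.
Qed.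

Lemma diag_inZ a u : a *: diag_in P u = diag_in P (fun i => a * u i).
Proof.
rewrite /diag_in scalemxAl scalemxAr -linearZ/=.
by congr (_ *m diag_mx _ *m _); apply/rowP => i; rewrite !mxE.
Qed.

Lemma diag_in_scalar a : diag_in P (fun=> a) = a%:M.
Proof.
rewrite /diag_in (_ : \row__ _ = const_mx a).
  by rewrite diag_const_mx mul_mx_scalar -scalemxAl mulVmx// scalemx1.
by apply/rowP => i; rewrite !mxE.
Qed.

Lemma diag_inX u k : diag_in P u ^+ k = diag_in P (fun i => u i ^+ k).
Proof.
elim: k => [|k IH].
  by rewrite (_ : (fun i => u i ^+ 0) = fun=> 1) ?diag_in_scalar.
rewrite exprS IH -mulmxE diag_inM; congr diag_in; apply/funext => i.
by rewrite exprS.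
Qed.

Lemma mxtrace_diag_in u : \tr (diag_in P u) = \sum_i u i.
Proof.
rewrite /diag_in -mulmxA mxtrace_mulC mulmxK// mxtrace_diag.
by apply: eq_bigr => i _; rewrite mxE.
Qed.

Lemma diag_in_inj u v : diag_in P u = diag_in P v -> u =1 v.
Proof.
move=> /(congr1 (fun M => P *m M *m invmx P)).
rewrite /diag_in !mulmxA mulmxV// !mul1mx !mulmxK// => /matrixP uv i.
by have := uv i i; rewrite !mxE eqxx.
Qed.

Lemma diag_in_expmx u : expmx (diag_in P u) = diag_in P (expR \o u).
Proof.
apply: cvg_lim; first exact: norm_hausdorff.
have -> : series (fun k => k`!%:R^-1 *: diag_in P u ^+ k) =
    fun k => invmx P *m diag_mx (\row_i series (exp_coeff (u i)) k) *m P.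
  apply/funext => k; elim: k => [|k IH].
    rewrite /series /= big_geq// (_ : \row__ _ = 0) ?raddf0 ?mulmx0 ?mul0mx//.
    by apply/rowP => i; rewrite !mxE big_geq.
  rewrite !seriesSr IH diag_inX diag_inZ [LHS]diag_inD /diag_in.
  congr (_ *m diag_mx _ *m _); apply/rowP => i; rewrite !mxE seriesSr.
  by rewrite /exp_coeff/= [_^-1 * _]mulrC.
apply: cvg_mulmx; apply: cvg_mx => i j; rewrite !mxE.
under eq_fun do rewrite !mxE.
have [->|ij] := eqVneq i j; rewrite ?mulr1n; last first.
  by under eq_fun do rewrite mulr0n; exact: cvg_cst.
under eq_fun do rewrite mulr1n.
exact: is_cvg_series_exp_coeff.
Qed.

End DiagIn.

(** * Roots and logarithms of matrices with simple spectrum *)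

(** Eigenvectors for distinct eigenvalues are independent. To see it, apply
    [prod_(i != j) (A - a i)] to a vanishing combination [c *m P]: only the term
    of index [j] survives, with a nonzero factor. *)
Lemma eigenvalues_diag_in (R : realType) (n : nat) (A : 'M[R]_n)
    (a : 'I_n -> R) :
  injective a -> (forall i, eigenvalue A (a i)) ->
  exists2 P : 'M[R]_n, P \in unitmx & A = diag_in P a.
Proof.
move=> aI eA.
have /choice[v vP] i : exists v : 'rV[R]_n, v *m A = a i *: v /\ v != 0.
  by have /eigenvalueP[v] := eA i; exists v.
pose P := \matrix_i v i.
have PA : P *m A = diag_mx (\row_i a i) *m P.
  apply/row_matrixP => i; rewrite row_mul rowK (vP i).1.
  by apply/rowP => j; rewrite mul_diag_mx !mxE.
have Punit : P \in unitmx.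
  rewrite -row_free_unit; apply/inj_row_free => c cP0.
  apply/rowP => j; rewrite mxE.
  have prodP s : exists M, P *m M =
      diag_mx (\row_k \prod_(i <- s) (a k - a i)) *m P.
    elim: s => [|i s [M PM]].
      exists 1%:M; rewrite mulmx1 (_ : \row__ _ = const_mx 1).
        by rewrite diag_const_mx mul1mx.
      by apply/rowP => k; rewrite !mxE big_nil.
    exists ((A - (a i)%:M) *m M).
    rewrite mulmxA mulmxBr PA mul_mx_scalar -mul_scalar_mx -mulmxBl.
    rewrite -mulmxA PM mulmxA -diag_const_mx -raddfB/= mulmx_diag.
    by congr (diag_mx _ *m _); apply/rowP => k; rewrite !mxE big_cons.
  have [M PM] := prodP [seq i <- enum 'I_n | i != j].
  have : c *m (P *m M) = 0 by rewrite mulmxA cP0 mul0mx.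
  rewrite PM mulmxA mul_mx_diag mulmx_sum_row (bigD1 j)//= big1 ?addr0;
    last first.
    move=> k kj; rewrite !mxE (bigD1_seq k)/= ?filter_uniq -?enumT ?enum_uniq//.
      by rewrite subrr mul0r mulr0 scale0r.
    by rewrite mem_filter kj mem_enum.
  rewrite [row j P]rowK => /eqP; rewrite scaler_eq0 (negPf (vP j).2) orbF !mxE.
  rewrite mulf_eq0 => /orP[/eqP//|/eqP pr0].
  have : \prod_(i <- [seq i <- enum 'I_n | i != j]) (a j - a i) != 0.
    rewrite big_filter big_enum_cond; apply/prodf_neq0 => i /andP[_ ij].
    by rewrite subr_eq0; apply: contra ij => /eqP/aI->.
  by rewrite pr0 eqxx.
by exists P => //; rewrite /diag_in -mulmxA -PA mulKmx.
Qed.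

Section SimpleSpectrum.
Context {R : realType} {n : nat} (P : 'M[R]_n) (Pu : P \in unitmx).
Implicit Types (u v : 'I_n -> R) (A X V : 'M[R]_n).

Lemma comm_diag_in u X : injective u -> comm_mx X (diag_in P u) ->
  exists v, X = diag_in P v.
Proof.
move=> uI cXu; pose Y := P *m X *m invmx P.
exists (fun i => Y i i).
suff YE : Y = diag_mx (\row_i Y i i).
  by rewrite /diag_in -YE /Y !mulmxA mulVmx// mul1mx mulmxKV.
have cY : Y *m diag_mx (\row_i u i) = diag_mx (\row_i u i) *m Y.
  have := congr1 (fun M => P *m M *m invmx P) cXu.
  by rewrite /diag_in /Y !mulmxA mulmxV// mul1mx mulmxK.
apply/matrixP => i j; rewrite !mxE.
have [->|ij] := eqVneq i j; first by rewrite mulr1n.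
rewrite mulr0n; move/matrixP/(_ i j): cY.
rewrite mul_mx_diag mul_diag_mx !mxE mulrC => /eqP.
rewrite -subr_eq0 -mulrBl mulf_eq0 subr_eq0 => /orP[/eqP/uI ji|/eqP//].
by rewrite ji eqxx in ij.
Qed.

(** The eigenvectors of a symmetric matrix with simple spectrum are pairwise
    orthogonal, so [P *m P^T] is diagonal and every matrix that [P] diagonalizes
    is symmetric too. *)
Lemma tr_diag_in u v : injective u -> (diag_in P u)^T = diag_in P u ->
  (diag_in P v)^T = diag_in P v.
Proof.
move=> uI uT.
(* The Gram matrix of the eigenvectors, kept opaque. *)
have [G GE] : exists G, G = P *m P^T by exists (P *m P^T).
have PTu : P^T \in unitmx by rewrite unitmx_tr.
have trE w : (diag_in P w)^T = P^T *m diag_mx (\row_i w i) *m invmx P^T.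
  by rewrite /diag_in !trmx_mul tr_diag_mx trmx_inv mulmxA.
have conjE w : (diag_in P w)^T = diag_in P w <->
    G *m diag_mx (\row_i w i) = diag_mx (\row_i w i) *m G.
  rewrite trE /diag_in GE; split=> [H|H].
    have := congr1 (fun M => P *m M *m P^T) H.
    by rewrite !mulmxA mulmxKV// mulmxV// mul1mx.
  have := congr1 (fun M => invmx P *m M *m invmx P^T) H.
  by rewrite !mulmxA mulVmx// mul1mx mulmxK.
apply/conjE; move/conjE: uT => cG.
apply/matrixP => i j; move/matrixP/(_ i j): cG.
rewrite !mul_mx_diag !mul_diag_mx !mxE => H.
have [->|ij] := eqVneq i j; first by rewrite mulrC.
suff -> : G i j = 0 by rewrite mul0r mulr0.
apply/eqP; move/eqP: H; rewrite mulrC -subr_eq0 -mulrBl mulf_eq0.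
by rewrite subr_eq0 => /orP[/eqP/uI ji|//]; rewrite ji eqxx in ij.
Qed.

Lemma row_mulmx_tr_gt0 (x : 'rV[R]_n) : x != 0 -> 0 < (x *m x^T) 0 0.
Proof.
move=> x0; rewrite mxE lt_neqAle; apply/andP; split; last first.
  by apply: sumr_ge0 => i _; rewrite mxE -expr2 sqr_ge0.
apply: contra x0 => /eqP /esym H; apply/eqP/rowP => i; rewrite mxE.
have /(_ H) : \sum_j x 0 j * x^T j 0 = 0 ->
    forall j, true -> x 0 j * x^T j 0 = 0.
  by apply/psumr_eq0P => j _; rewrite mxE -expr2 sqr_ge0.
by move=> /(_ i isT) /eqP; rewrite mxE mulf_eq0 orbb => /eqP.
Qed.

(** The matrix is [W^T *m W] for the invertible symmetric [W] with eigenvalues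
    [sqrt (u i)]. *)
Lemma posdefmx_diag_in u : (forall v, (diag_in P v)^T = diag_in P v) ->
  (forall i, 0 < u i) -> posdefmx (diag_in P u).
Proof.
move=> dT u0 x x0; pose W := diag_in P (fun i => Num.sqrt (u i)).
have -> : diag_in P u = W^T *m W.
  rewrite dT diag_inM//; congr diag_in; apply/funext => i.
  by rewrite -expr2 sqr_sqrtr// ltW.
rewrite mulmxA -trmx_mul -mulmxA -[X in _ *m X]trmxK.
apply: row_mulmx_tr_gt0; apply: contra x0 => /eqP /(congr1 trmx).
rewrite trmxK trmx0 => Wx0.
suff <- : diag_in P (fun i => (Num.sqrt (u i))^-1) *m (W *m x) = x.
  by rewrite Wx0 mulmx0.
rewrite mulmxA diag_inM// (_ : (fun i => _) = fun=> 1).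
  by rewrite diag_in_scalar// mul1mx.
by apply/funext => i; rewrite mulVf// sqrtr_eq0 -ltNge.
Qed.

Lemma posdef_diag_in_gt0 u : posdefmx (diag_in P u) -> forall i, 0 < u i.
Proof.
move=> pd i; pose p := row i P.
have p0 : p != 0.
  apply/eqP => p0; have := mulmxV Pu => /(congr1 (row i)).
  rewrite row_mul -/p p0 mul0mx => /rowP/(_ i); rewrite !mxE eqxx => /eqP.
  by rewrite eq_sym oner_eq0.
have pV : p *m diag_in P u = u i *: p.
  rewrite /p -row_mul /diag_in !mulmxA mulmxV// mul1mx.
  by apply/rowP => j; rewrite mul_diag_mx !mxE.
have := pd p^T; rewrite trmxK pV -scalemxAl mxE.
rewrite pmulr_lgt0 ?row_mulmx_tr_gt0//; apply.
by apply: contra p0 => /eqP p0; rewrite -(trmxK p) p0 trmx0.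
Qed.

(** A square root [V] commutes with its square, so it is [diag_in P v] with
    [v i ^+ 2 = u i ^+ 2]; positivity selects the sign. *)
Lemma sqrtmx_diag_in u : injective u -> (forall i, 0 < u i) ->
  (diag_in P (fun i => u i ^+ 2))^T = diag_in P (fun i => u i ^+ 2) ->
  sqrtmx (diag_in P (fun i => u i ^+ 2)) = diag_in P u.
Proof.
move=> uI u0 uT.
have u2I : injective (fun i => u i ^+ 2).
  by move=> i j /eqP; rewrite eqrXn2 ?ltW// => /eqP/uI.
have dT v : (diag_in P v)^T = diag_in P v by apply: tr_diag_in uT.
have [VT Vpd VV] : [set V | [/\ V^T = V, posdefmx V &
    V *m V = diag_in P (fun i => u i ^+ 2)]]
    (sqrtmx (diag_in P (fun i => u i ^+ 2))).
  apply: xgetPex; exists (diag_in P u); split; first exact: dT.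
    exact: posdefmx_diag_in.
  by rewrite diag_inM.
set V := sqrtmx _ in VT Vpd VV *.
have [v vE] : exists v, V = diag_in P v.
  by apply: (comm_diag_in u2I); rewrite -VV /comm_mx mulmxA.
rewrite vE; congr diag_in; apply/funext => i.
have v0 : 0 < v i by apply: posdef_diag_in_gt0; rewrite -vE.
apply/eqP; rewrite -(@eqrXn2 _ 2) ?ltW//; apply/eqP.
by move: VV; rewrite vE diag_inM// => /diag_in_inj/(_ i); rewrite -expr2; apply.
Qed.

(** A real logarithm [X] commutes with its exponential, so it is [diag_in P v]
    with [expR (v i) = expR (u i)]. That [diag_in P u] itself is principal holds
    because its complex eigenvalues are the [u i]. *)
Lemma logmx_diag_in u : injective u ->
  logmx (diag_in P (expR \o u)) = diag_in P u.
Proof.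
move=> uI.
have euI : injective (expR \o u) by move=> i j /expR_inj/uI.
have [XV _] : [set X | expmx X = diag_in P (expR \o u) /\
    forall z : R[i], eigenvalue (map_mx (real_complex R) X) z ->
      `|complex.Im z| < pi] (logmx (diag_in P (expR \o u))).
  apply: xgetPex; exists (diag_in P u); split; first exact: diag_in_expmx.
  move=> z /eigenvalueP[x xz x0].
  pose y := x *m invmx (map_mx (real_complex R) P).
  have PCu : map_mx (real_complex R) P \in unitmx by rewrite map_unitmx.
  have y0 : y != 0.
    by apply: contra x0 => /eqP y0; rewrite -(mulmxKV PCu x) -/y y0 mul0mx.
  have yz : y *m map_mx (real_complex R) (diag_mx (\row_i u i)) = z *: y.
    move: xz; rewrite /diag_in !map_mxM map_invmx.
    move=> /(congr1 (fun w => w *m invmx (map_mx (real_complex R) P))).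
    by rewrite -scalemxAl -/y !mulmxA mulmxK.
  clearbody y; have /rV0Pn[i yi] := y0.
  move/rowP/(_ i): yz; rewrite map_diag_mx mul_mx_diag !mxE mulrC.
  by move=> yz; have <- /= := mulIf yi yz; rewrite normr0 pi_gt0.
set X := logmx _ in XV *.
have [v vE] : exists v, X = diag_in P v.
  by apply: (comm_diag_in euI); rewrite -XV; exact: comm_expmx.
rewrite vE; congr diag_in; apply/funext => i.
move: XV; rewrite vE diag_in_expmx// => /diag_in_inj -/(_ Pu i)/=.
exact: expR_inj.
Qed.

End SimpleSpectrum.

(** * The isochoric logarithmic strain *)

Definition hencky_sq (R : realType) (n : nat) (F : 'M[R]_n) :=
  frobenius_sq (devmx (logmx (sqrtmx (F *m F^T)))).

Lemma hencky_sq_sum (R : realType) (n : nat) (F : 'M[R]_n) (u : 'I_n -> R) :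
  injective u -> (forall i, eigenvalue (F *m F^T) (expR (u i) ^+ 2)) ->
  hencky_sq F = \sum_i u i ^+ 2 - n%:R^-1 * (\sum_i u i) ^+ 2.
Proof.
move=> uI eF.
have euI : injective (expR \o u) by move=> i j /expR_inj/uI.
have e2I : injective (fun i => expR (u i) ^+ 2).
  by move=> i j /eqP; rewrite eqrXn2 ?expR_ge0// => /eqP/euI.
have [P Pu FP] := eigenvalues_diag_in e2I eF.
have FT : (diag_in P (fun i => expR (u i) ^+ 2))^T =
    diag_in P (fun i => expR (u i) ^+ 2) by rewrite -FP trmx_mul trmxK.
rewrite /hencky_sq FP (@sqrtmx_diag_in _ _ P Pu (expR \o u))//; last first.
  by move=> i; exact: expR_gt0.
rewrite logmx_diag_in// /frobenius_sq /devmx mxtrace_diag_in//.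
set S := \sum_i u i; set c := n%:R^-1 * S.
have -> : diag_in P u - c%:M = diag_in P (fun i => u i + - c).
  by rewrite -diag_inD; congr (_ + _); rewrite diag_in_scalar// raddfN.
rewrite (tr_diag_in Pu _ e2I FT) diag_inM// mxtrace_diag_in//.
transitivity (\sum_i u i ^+ 2 - 2 * c * S + n%:R * c ^+ 2).
  rewrite (eq_bigr (fun i => u i ^+ 2 - 2 * c * u i + c ^+ 2)); last first.
    by move=> i _; ring.
  rewrite big_split sumrB/= -mulr_sumr sumr_const card_ord.
  by rewrite -[c ^+ 2 *+ _]mulr_natl.
rewrite /c; have [n0|n0] := posnP n.
  have -> : n%:R = 0 :> R by rewrite n0.
  by rewrite invr0; ring.
have : n%:R != 0 :> R by rewrite pnatr_eq0 -lt0n.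
by move=> ?; field.
Qed.

(** * Completion by a constant diagonal block *)

Lemma eigenvalue_block_diag (F : fieldType) (k m : nat) (A : 'M[F]_k)
    (B : 'M[F]_m) a :
  eigenvalue A a || eigenvalue B a -> eigenvalue (block_mx A 0 0 B) a.
Proof.
rewrite !eigenvalue_root_char /char_poly char_block_diag_mx det_ublock.
by rewrite rootM.
Qed.

Section BlockLine.
Context {R : realType} {k m : nat}.
Implicit Types (A : 'M[R]_k) (a b : 'cV[R]_k) (v : 'I_k -> R) (w : 'I_m -> R).

Definition pad w A : 'M[R]_(k + m) :=
  block_mx A 0 0 (diag_mx (\row_i expR (w i))).

(** What the diagonal block [expR \o w] contributes to [hencky_sq] when the
    other block has determinant [1]; the cross term of the squared trace
    vanishes then. *)
Definition pad_sq w : R :=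
  \sum_i w i ^+ 2 - (k + m)%:R^-1 * (\sum_i w i) ^+ 2.

Lemma hencky_sq_pad w A v :
  injective w -> injective v -> (forall i j, v i != w j) -> \sum_i v i = 0 ->
  (forall i, eigenvalue (A *m A^T) (expR (v i) ^+ 2)) ->
  hencky_sq (pad w A) = \sum_i v i ^+ 2 + pad_sq w.
Proof.
move=> wI vI vw v0 eA.
pose u (i : 'I_(k + m)) :=
  match fintype.split i with inl i => v i | inr j => w j end.
have ul i : u (lshift m i) = v i.
  by rewrite /u -[lshift m i]/(unsplit (inl i)) unsplitK.
have ur j : u (rshift k j) = w j.
  by rewrite /u -[rshift k j]/(unsplit (inr j)) unsplitK.
rewrite (@hencky_sq_sum _ _ _ u).
- rewrite !big_split_ord/=.
  under eq_bigr do rewrite ul.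
  under [X in _ + X - _]eq_bigr do rewrite ur.
  under [X in _ - _ * (X + _) ^+ 2]eq_bigr do rewrite ul.
  under [X in _ - _ * (_ + X) ^+ 2]eq_bigr do rewrite ur.
  by rewrite v0 add0r -addrA.
- move=> i j; case: (split_ordP i) => i' ->; case: (split_ordP j) => j' ->;
    rewrite ?ul ?ur.
  + by move/vI->.
  + by move=> /eqP; rewrite (negPf (vw _ _)).
  + by move=> /esym/eqP; rewrite (negPf (vw _ _)).
  + by move/wI->.
- move=> i; rewrite /pad tr_block_mx !trmx0 mulmx_block.
  rewrite !(mulmx0, mul0mx) !add0r !addr0 tr_diag_mx mulmx_diag.
  apply: eigenvalue_block_diag.
  case: (split_ordP i) => j ->; rewrite ?ul ?ur.
    by rewrite eA.
  apply/orP; right; apply/eigenvalueP; exists (delta_mx 0 j).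
    by rewrite -rowE row_diag_mx !mxE expr2.
  apply/eqP => /rowP/(_ j)/eqP; rewrite !mxE !eqxx.
  by rewrite oner_eq0.
Qed.

(** On a rank-one line of determinant [1] in the first block the determinant of
    the completed matrix is constant, and so is the volumetric term: convexity
    passes to the isochoric term alone. *)
Lemma rank_one_convex_pad (Psi Wvol : R -> R) w A a b :
  rank_one_convex
    (fun F : 'M[R]_(k + m) => Psi (hencky_sq F) + Wvol (\det F)) ->
  (forall t, \det (A + t *: tensormx a b) = 1) ->
  forall x y l : R, 0 <= l -> l <= 1 ->
  let h t := Psi (hencky_sq (pad w (A + t *: tensormx a b))) in
  h (l * x + (1 - l) * y) <= l * h x + (1 - l) * h y.
Proof.
move=> roc dA x y l l0 l1 /=.
have cancel_const (p q r c : R) :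
    p + c <= l * (q + c) + (1 - l) * (r + c) -> p <= l * q + (1 - l) * r.
  by rewrite (_ : _ + _ * (r + c) = l * q + (1 - l) * r + c) ?lerD2r//; ring.
pose a' : 'cV[R]_(k + m) := col_mx a 0; pose b' : 'cV[R]_(k + m) := col_mx b 0.
have padE t : pad w A + t *: tensormx a' b' = pad w (A + t *: tensormx a b).
  rewrite /pad (_ : tensormx a' b' = block_mx (tensormx a b) 0 0 0).
    by rewrite scale_block_mx !scaler0 add_block_mx !addr0.
  apply/matrixP => i j.
  by case: (split_ordP i) => i' ->; case: (split_ordP j) => j' ->;
    rewrite mxE ?block_mxEul ?block_mxEur ?block_mxEdl ?block_mxEdr
            ?col_mxEu ?col_mxEd !mxE ?mulr0 ?mul0r.
have detE t : \det (pad w (A + t *: tensormx a b)) = \prod_i expR (w i).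
  rewrite /pad det_ublock dA mul1r det_diag.
  by apply: eq_bigr => i _; rewrite mxE.
have det0 t : GLpos (pad w A + t *: tensormx a' b').
  by rewrite /GLpos/= padE detE; apply: prodr_gt0 => i _; exact: expR_gt0.
have Fpos : GLpos (pad w A) by have := det0 0; rewrite scale0r addr0.
have iT : is_interval [set: R] by [].
have := roc (pad w A) a' b' setT Fpos iT (fun t _ => det0 t) (Itv01 l0 l1) x y.
rewrite !inE => /(_ I I).
rewrite !convRE/= !padE !detE /unstable.onem.
rewrite [conv (Itv01 l0 l1) _ _](_ : _ = l * x + (1 - l) * y)//.
exact: cancel_const.
Qed.

End BlockLine.

(** * Simple shear and monotonicity *)

Lemma det_mx22 (R : comNzRingType) (A : 'M[R]_2) :
  \det A = A 0 0 * A 1 1 - A 0 1 * A 1 0.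
Proof.
have l00 : lift 0 0 = 1 :> 'I_2 by exact: ord_inj.
have l10 : lift 1 0 = 0 :> 'I_2 by exact: ord_inj.
rewrite (expand_det_row _ 0) !big_ord_recl big_ord0 /cofactor !det_mx11 !mxE.
by rewrite !l00 !l10 /= expr0 expr1; ring.
Qed.

Lemma det_mx33 (R : comNzRingType) (A : 'M[R]_3) :
  \det A = A 0 0 * (A 1 1 * A 2 2 - A 1 2 * A 2 1)
         - A 0 1 * (A 1 0 * A 2 2 - A 1 2 * A 2 0)
         + A 0 2 * (A 1 0 * A 2 1 - A 1 1 * A 2 0).
Proof.
have l00 : lift 0 0 = 1 :> 'I_3 by exact: ord_inj.
have l01 : lift 0 1 = 2 :> 'I_3 by exact: ord_inj.
have l10 : lift 1 0 = 0 :> 'I_3 by exact: ord_inj.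
have l11 : lift 1 1 = 2 :> 'I_3 by exact: ord_inj.
have l20 : lift 2 0 = 0 :> 'I_3 by exact: ord_inj.
have l21 : lift 2 1 = 1 :> 'I_3 by exact: ord_inj.
have k0 : lift 0 0 = 1 :> 'I_2 by exact: ord_inj.
rewrite (expand_det_row _ 0) !big_ord_recl big_ord0 /cofactor !det_mx22 !mxE.
rewrite !k0 !l00 !l01 !l10 !l11 !l20 !l21 /= expr0 expr1 sqrrN expr1n.
by ring.
Qed.

Lemma eigenvalue_det (F : fieldType) (n : nat) (A : 'M[F]_n) a :
  eigenvalue A a = (\det (A - a%:M) == 0).
Proof.
by rewrite /eigenvalue kermx_eq0 row_free_unit unitmxE unitfE negbK.
Qed.

(** The shear by [t = z - z^-1] has singular values [|z|] and [|z|^-1]. As [t]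
    is unchanged under [z |-> - z^-1], the second eigenvalue [z^-2] is an
    instance of the same statement. *)
Lemma eigenvalue_shear (R : realType) (z : R) (A : 'M[R]_2) : z != 0 ->
  A = 1%:M + (z - z^-1) *: tensormx (delta_mx 0 0) (delta_mx 1 0) ->
  eigenvalue (A *m A^T) (z ^+ 2).
Proof.
move=> z0 ->; rewrite eigenvalue_det det_mx22; apply/eqP.
rewrite !mxE !big_ord_recl !big_ord0 !mxE /=.
by field.
Qed.

(** The values [Psi s] with [r <= s] are those of an even convex function at the
    points [+- tau s]. Evenness is built into the sign [(-1) ^+ e] of one of the
    two end points. *)
Definition even_convex_above (R : realType) (Psi : R -> R) (r : R) :=
  exists tau : R -> R,
  [/\ forall s, r <= s -> 0 < tau s,
      forall s s', r <= s -> s < s' -> tau s < tau s' &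
      forall (e : bool) l s s1 s2, 0 <= l -> l <= 1 ->
        r <= s -> r <= s1 -> r <= s2 ->
        tau s = l * ((-1) ^+ e * tau s1) + (1 - l) * tau s2 ->
        Psi s <= l * Psi s1 + (1 - l) * Psi s2].

(** The shear line reaches the value [s] of [hencky_sq] at [+- tau s], where
    [tau s = exp y - exp (- y)] and [2 y^2 + pad_sq w = s]. The completing block
    has logarithms [delta * j], with [delta] so small that [pad_sq w < r] and
    that they differ from [+- y] as soon as [r <= s]. *)
Lemma rank_one_convex_even_convex (R : realType) (m : nat)
    (Psi Wvol : R -> R) (r : R) :
  rank_one_convex
    (fun F : 'M[R]_(2 + m) => Psi (hencky_sq F) + Wvol (\det F)) ->
  0 < r -> even_convex_above Psi r.
Proof.
move=> roc r0.
(* With [w j = delta * j] one has [pad_sq w <= delta^2 m^3] and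
   [w j ^+ 2 <= delta^2 m^2], so [w j ^+ 2 < (r - pad_sq w) / 2] follows from
   [delta^2 (m^3 + 2 m^2) < r]. *)
pose N : R := m%:R ^+ 3 + 2 * m%:R ^+ 2.
have N0 : 0 <= N by rewrite addr_ge0 ?mulr_ge0 ?exprn_ge0.
pose delta := Num.sqrt (r / (N + 1)).
have d2 : delta ^+ 2 = r / (N + 1).
  by rewrite sqr_sqrtr// divr_ge0 ?addr_ge0// ltW.
have d0 : 0 < delta by rewrite sqrtr_gt0 divr_gt0// ltr_wpDl.
have dN : delta ^+ 2 * N < r.
  by rewrite d2 mulrAC ltr_pdivrMr ?ltr_wpDl// ltr_pM2l// ltrDl.
pose w (j : 'I_m) := delta * j%:R.
have wI : injective w.
  by move=> i j /(mulfI (lt0r_neq0 d0))/eqP; rewrite eqr_nat => /eqP/val_inj.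
have w2 j : w j ^+ 2 <= delta ^+ 2 * m%:R ^+ 2.
  rewrite exprMn ler_pM2l ?exprn_gt0// lerXn2r ?nnegrE// ler_nat.
  exact: ltnW.
pose c := pad_sq (k := 2) w.
have c_le : c <= delta ^+ 2 * m%:R ^+ 3.
  apply: (@le_trans _ _ (\sum_i w i ^+ 2)).
    by rewrite /c /pad_sq gerBl mulr_ge0 ?invr_ge0// sqr_ge0.
  apply: (@le_trans _ _ (\sum_(i < m) delta ^+ 2 * m%:R ^+ 2)).
    by apply: ler_sum => i _; exact: w2.
  rewrite sumr_const card_ord -mulr_natl.
  by rewrite le_eqVlt; apply/orP; left; apply/eqP; ring.
have cr s : r <= s -> delta ^+ 2 * m%:R ^+ 2 < (s - c) / 2.
  by move=> rs; rewrite ltr_pdivlMr//; move: dN; rewrite /N; lra.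
pose y s := Num.sqrt ((s - c) / 2).
have cr0 s : r <= s -> 0 < (s - c) / 2.
  by move=> /cr; apply: le_lt_trans; rewrite mulr_ge0 ?exprn_ge0// ltW.
have y2 s : r <= s -> y s ^+ 2 = (s - c) / 2.
  by move=> /cr0/ltW H; rewrite sqr_sqrtr.
have y0 s : r <= s -> 0 < y s by move=> /cr0 H; rewrite sqrtr_gt0.
pose t (z : R) := expR z - (expR z)^-1.
pose h (z : R) := Psi (hencky_sq (pad w ((1%:M : 'M[R]_2) +
  z *: tensormx (delta_mx 0 0) (delta_mx 1 0)))).
have hE s (e : bool) : r <= s -> h ((-1) ^+ e * t (y s)) = Psi s.
  move=> rs; rewrite /h.
  have -> : (-1) ^+ e * t (y s) = t ((-1) ^+ e * y s).
    by case: e; rewrite /t ?expr0 ?expr1 ?mul1r// !mulN1r expRN invrK; ring.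
  set z := (-1) ^+ e * y s.
  have z2 : z ^+ 2 = (s - c) / 2 by rewrite exprMn sqrr_sign mul1r y2.
  have z0 : z != 0 by rewrite mulf_neq0 ?signr_eq0// lt0r_neq0// y0.
  have zN : z != - z by rewrite -subr_eq0 opprK -mulr2n mulrn_eq0.
  rewrite (hencky_sq_pad (v := fun i : 'I_2 => if i == 0 then z else - z))//.
  - by rewrite !big_ord_recl big_ord0/= sqrrN z2 -/c; congr Psi; field.
  - case=> [[|[|//]] i] [[|[|//]] j] /= => /eqP zz; apply: val_inj => //=.
      by rewrite (negPf zN) in zz.
    by rewrite eq_sym (negPf zN) in zz.
  - move=> i j; apply/eqP => /(congr1 (fun a => a ^+ 2)).
    rewrite (fun_if (fun a => a ^+ 2)) sqrrN if_same z2 => zw.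
    by have := w2 j; rewrite -zw leNgt cr.
  - by rewrite !big_ord_recl big_ord0/= addr0 subrr.
  - move=> i; rewrite /t.
    case: ifP => _.
      by apply: eigenvalue_shear; rewrite ?gt_eqF ?expR_gt0.
    rewrite (_ : _ - _ = (- expR (- z)) - (- expR (- z))^-1).
      rewrite -[_ ^+ 2]sqrrN.
      by apply: eigenvalue_shear; rewrite ?oppr_eq0 ?gt_eqF ?expR_gt0.
    by rewrite expRN invrN invrK; ring.
exists (t \o y); split => /=.
- by move=> s /y0 ys; rewrite /t subr_gt0 -expRN ltr_expR; lra.
- move=> s s' rs ss'; rewrite /t.
  have yy : y s < y s' by rewrite ltr_sqrt ?cr0//; lra.
  by rewrite -!expRN ltrB// ltr_expR// ltrN2.
- move=> e l s s1 s2 l0 l1 rs rs1 rs2 tE.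
  rewrite -(hE s false)// -(hE s1 e)// -(hE s2 false)// !expr0 !mul1r tE.
  apply: (rank_one_convex_pad w roc) => // u.
  rewrite det_mx22 !mxE/=.
  by ring.
Qed.

(** Evenness and convexity make [Psi] nondecreasing. If [Psi x = Psi z] with
    [x < z], then by convexity [Psi] is constant on the positive axis up to [z],
    and difference quotients at [0] with a positive limit would force that
    constant to exceed [Psi 0] by an amount of the order of [y], for every small
    [y]. *)
Lemma increasing_of_even_convex (R : realType) (Psi : R -> R) :
  (forall r, 0 < r -> even_convex_above Psi r) ->
  derivable_within `[0, +oo[ Psi 0 -> 0 < derive_within `[0, +oo[ Psi 0 ->
  forall x z, 0 < x -> x < z -> Psi x < Psi z.
Proof.
move=> fam dPsi dPsi0.
have mono x z : 0 < x -> x < z -> Psi x <= Psi z.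
  move=> x0 xz; have [tau [tau0 tau_lt conv]] := fam x x0.
  have tx := tau0 _ (lexx x); have tz := tau0 _ (ltW xz).
  have txz := tau_lt _ _ (lexx x) xz.
  have tz0 : tau z != 0 by rewrite gt_eqF.
  pose l := (tau z - tau x) / (tau z * 2).
  have l0 : 0 <= l by rewrite divr_ge0 ?subr_ge0 ?mulr_ge0// ltW.
  have l1 : l <= 1 by rewrite ler_pdivrMr ?mulr_gt0// mul1r; lra.
  have -> : Psi z = l * Psi z + (1 - l) * Psi z by ring.
  apply: (conv true) => //; rewrite ?ltW// expr1 /l.
  by field.
move=> x z x0 xz; rewrite lt_neqAle mono// andbT; apply/eqP => Pxz.
have cst s : 0 < s -> s < x -> Psi s = Psi x.
  move=> s0 sx; apply/eqP; rewrite eq_le mono//=.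
  have [tau [tau0 tau_lt conv]] := fam s s0.
  have sz := lt_trans sx xz.
  have t1 := tau_lt _ _ (lexx s) sx.
  have t2 := tau_lt _ _ (ltW sx) xz.
  have t3 : 0 < tau z - tau s by lra.
  pose l := (tau z - tau x) / (tau z - tau s).
  have l0 : 0 < l by rewrite divr_gt0//; lra.
  have l1 : l <= 1 by rewrite ler_pdivrMr ?mul1r//; lra.
  have : Psi x <= l * Psi s + (1 - l) * Psi z.
    apply: (conv false) => //; rewrite ?ltW// expr0 mul1r /l.
    by field; rewrite gt_eqF.
  by rewrite -Pxz => H; rewrite -(ler_pM2l l0); lra.
set L := derive_within _ _ _ in dPsi0.
have : \forall y \near within `[0, +oo[ (0 : R)^',
    `|L - (Psi y - Psi 0) / (y - 0)| < L / 2.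
  by move/cvgrPdist_lt : dPsi; apply; rewrite divr_gt0.
rewrite near_withinE /= /dnbhs near_withinE => /nbhs_ballP[e /= e0 He].
have near y : 0 < y -> y < e -> y * (L / 2) < Psi y - Psi 0 < y * (3 * L / 2).
  move=> y0 ye.
  have := He y; rewrite /ball/= sub0r normrN gtr0_norm// => /(_ ye).
  rewrite gt_eqF// => /(_ isT); rewrite in_itv/= andbT ltW// => /(_ isT).
  rewrite subr0 ltr_distlC => /andP[].
  by rewrite ltr_pdivlMr// ltr_pdivrMr// => H1 H2; apply/andP; split; lra.
pose y := Num.min (e / 2) (x / 2).
have ye : y <= e / 2 by rewrite ge_min lexx.
have yx : y <= x / 2 by rewrite ge_min lexx orbT.
have y0 : 0 < y by rewrite lt_min !divr_gt0.
(* [y * (L / 2) < Psi x - Psi 0 < y / 4 * (3 * L / 2)] is contradictory. *)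
have /andP[H1 _] : y * (L / 2) < Psi y - Psi 0 < y * (3 * L / 2).
  by apply: near; lra.
have /andP[_ H2] :
    y / 4 * (L / 2) < Psi (y / 4) - Psi 0 < y / 4 * (3 * L / 2).
  by apply: near; lra.
rewrite cst in H1; try lra.
rewrite cst in H2; try lra.
have : 0 < y * L by rewrite mulr_gt0.
lra.
Qed.

(** * A rank-one line on which the strain is not quasi-convex *)

Section PivotLine.
Context {R : realType}.
Implicit Types b d t l : R.

(** Up to rotations and scaling, a rank-one line of constant determinant in
    dimension [3] has its direction at one corner and a singular complementary
    [2 x 2] block. The other entries are normalized so that the determinant is
    [1] and that [|F|^2 = t^2 + K] and [|Cof F|^2 = (t - b d)^2 + K] share the
    constant [K = b^2 + d^2 + 3]. *)
Definition pivot b d t : 'M[R]_3 :=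
  \matrix_(i, j) nth 0 (nth [::]
    [:: [:: 0; b; 1];
        [:: d; 1; 0];
        [:: -1; 0; 0]] i) j + t *: tensormx (delta_mx 0 0) (delta_mx 0 0).

Lemma det_pivot b d t : \det (pivot b d t) = 1.
Proof. by rewrite det_mx33 !mxE/=; ring. Qed.

Lemma eigenvalue_pivot b d t l :
  eigenvalue (pivot b d t *m (pivot b d t)^T) l =
  (l ^+ 3 - (t ^+ 2 + (b ^+ 2 + d ^+ 2 + 3)) * l ^+ 2
   + ((t - b * d) ^+ 2 + (b ^+ 2 + d ^+ 2 + 3)) * l - 1 == 0).
Proof.
rewrite eigenvalue_det det_mx33 -oppr_eq0; congr (_ == 0).
rewrite !mxE !big_ord_recl !big_ord0 !mxE /=.
ring.
Qed.

(** The reflection [t |-> b d - t] exchanges [|F|^2] and [|Cof F|^2], hence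
    inverts the singular values. *)
Lemma eigenvalue_pivotV b d t l : l != 0 ->
  eigenvalue (pivot b d (b * d - t) *m (pivot b d (b * d - t))^T) l^-1 =
  eigenvalue (pivot b d t *m (pivot b d t)^T) l.
Proof.
move=> l0; rewrite !eigenvalue_pivot.
set p := (X in _ = (X == 0)).
rewrite (_ : _ - 1 = - (l^-1 ^+ 3) * p); last by rewrite /p; field.
by rewrite mulf_eq0 oppr_eq0 expf_eq0 invr_eq0 (negPf l0).
Qed.

(** Eigenvalues [x], [y], [(x y)^-1] of [F F^T] at [t = 0] amount to
    [K = x + y + (x y)^-1] and [(b d)^2 = (x - 1) (y - 1) (1 - (x y)^-1)]. Real
    [b], [d] with [b^2 + d^2 + 3 = K] exist if [2 b d <= K - 3], which for large
    [x] and [y] prevents them from being too close. At [t = b d / 2] the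
    characteristic polynomial is antipalindromic, with roots [1], [mu], [mu^-1],
    and [mu] is about [x y / 4]. The sum of the squared logarithms is larger
    there when [ln mu ^ 2 > ln x ^ 2 + ln x * ln y + ln y ^ 2]; with [x = 2 ^ 7]
    and [y = 2 ^ 9] the right-hand side is [193 * ln 2 ^ 2], less than
    [(14 * ln 2) ^ 2]. *)
Lemma pivot_exists : exists b d mu : R,
  [/\ 2 ^+ 14 < mu,
      forall l, l \in [:: 2 ^+ 7; 2 ^+ 9; (2 ^+ 16)^-1] ->
        eigenvalue (pivot b d 0 *m (pivot b d 0)^T) l &
      forall l, l \in [:: mu; 1; mu^-1] ->
        eigenvalue (pivot b d (b * d / 2) *m (pivot b d (b * d / 2))^T) l].
Proof.
pose K : R := 2 ^+ 7 + 2 ^+ 9 + (2 ^+ 16)^-1.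
pose T2 : R := 127 * 511 * (1 - (2 ^+ 16)^-1).
pose T := Num.sqrt T2.
have q0 : (2 ^+ 16)^-1 > 0 :> R by rewrite invr_gt0 exprn_gt0.
have q1 : (2 ^+ 16)^-1 <= 2^-1 :> R.
  by rewrite lef_pV2 ?posrE ?exprn_gt0//; lra.
have T2E : T ^+ 2 = T2 by rewrite sqr_sqrtr// /T2; lra.
have T0 : 0 <= T by exact: sqrtr_ge0.
have T255 : T <= 255.
  rewrite -[leRHS]ger0_norm// -sqrtr_sqr ler_wsqrtr// /T2; lra.
pose p := Num.sqrt (K - 3 + 2 * T); pose q := Num.sqrt (K - 3 - 2 * T).
have p2 : p ^+ 2 = K - 3 + 2 * T by rewrite sqr_sqrtr// /K; lra.
have q2 : q ^+ 2 = K - 3 - 2 * T by rewrite sqr_sqrtr// /K; lra.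
pose b := (p + q) / 2; pose d := (p - q) / 2.
have bdT : b * d = T.
  have -> : b * d = (p ^+ 2 - q ^+ 2) / 4 by rewrite /b /d; field.
  by rewrite p2 q2; field.
have bdK : b ^+ 2 + d ^+ 2 + 3 = K.
  have -> : b ^+ 2 + d ^+ 2 = (p ^+ 2 + q ^+ 2) / 2 by rewrite /b /d; field.
  by rewrite p2 q2; field.
(* The sum of [mu] and [mu^-1]. *)
pose M := T2 / 4 + K - 1.
have M2 : 2 ^+ 14 + 1 < M by rewrite /M /T2 /K; lra.
pose D := Num.sqrt (M ^+ 2 - 4).
have D2 : D ^+ 2 = M ^+ 2 - 4 by rewrite sqr_sqrtr//; nra.
have DM : M - 2 <= D.
  rewrite -[leLHS]ger0_norm; last by lra.
  by rewrite -sqrtr_sqr ler_wsqrtr//; nra.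
pose mu := (M + D) / 2.
have muM : 2 ^+ 14 < mu by rewrite /mu; lra.
have mu0 : mu != 0 by rewrite gt_eqF//; apply: lt_trans muM; rewrite exprn_gt0.
have muE : mu ^+ 2 = M * mu - 1.
  have -> : mu ^+ 2 = (M ^+ 2 + 2 * M * D + D ^+ 2) / 4 by rewrite /mu; field.
  by rewrite D2 /mu; field.
exists b, d, mu; split => // l.
  rewrite eigenvalue_pivot bdT bdK sub0r sqrrN T2E expr0n add0r.
  by rewrite !inE => /or3P[] /eqP->; apply/eqP; rewrite /K /T2; field.
rewrite eigenvalue_pivot bdT bdK.
have -> : T / 2 - T = - (T / 2) by field.
rewrite sqrrN expr_div_n T2E.
have -> : T2 / 2 ^+ 2 + K = M + 1 by rewrite /M; field.
have fact x : x ^+ 3 - (M + 1) * x ^+ 2 + (M + 1) * x - 1 =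
  (x - 1) * (x ^+ 2 - M * x + 1) by ring.
rewrite fact mulf_eq0 !inE => /or3P[] /eqP->; apply/orP; [right|left|right].
- by rewrite muE; apply/eqP; ring.
- by rewrite subrr.
rewrite (_ : _ + 1 = (mu ^+ 2 - M * mu + 1) / mu ^+ 2); last by field.
by rewrite muE mulf_eq0; apply/orP; left; apply/eqP; ring.
Qed.

End PivotLine.

(** * Conclusion *)

(** [pad_sq w] is the sum of the squared distances of the [w i] and of [k] zeros
    to their common mean. *)
Lemma pad_sq_ge0 (R : realType) (k m : nat) (w : 'I_m -> R) :
  0 <= pad_sq (k := k) w.
Proof.
rewrite /pad_sq; set S := \sum_i w i.
have [km0|km0] := posnP (k + m).
  by rewrite km0 invr0 mul0r subr0; apply: sumr_ge0 => i _; exact: sqr_ge0.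
have N0 : (k + m)%:R != 0 :> R by rewrite pnatr_eq0 -lt0n.
pose c := S / (k + m)%:R.
suff -> : \sum_i w i ^+ 2 - (k + m)%:R^-1 * S ^+ 2 =
    \sum_i (w i - c) ^+ 2 + k%:R * c ^+ 2.
  apply: addr_ge0; first by apply: sumr_ge0 => i _; exact: sqr_ge0.
  by apply: mulr_ge0 => //; exact: sqr_ge0.
have -> : \sum_i (w i - c) ^+ 2 = \sum_i w i ^+ 2 - 2 * c * S + m%:R * c ^+ 2.
  rewrite (eq_bigr (fun i => w i ^+ 2 - 2 * c * w i + c ^+ 2)); last first.
    by move=> i _; ring.
  rewrite big_split sumrB/= -mulr_sumr sumr_const card_ord.
  by rewrite -[c ^+ 2 *+ _]mulr_natl.
have -> : k%:R = (k + m)%:R - m%:R :> R by rewrite natrD addrK.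
by rewrite /c; move: (k + m)%:R N0 => N N0; field.
Qed.

Theorem theorem6p1 (R : realType) (n : nat) (hn : (3 <= n)%N) :
  ~ exists Psi Wvol : R -> R,
      [/\ C2_on `[0, +oo[ Psi,
          C2_on `[0, +oo[ Wvol,
          0 < derive_within `[0, +oo[ Psi 0 &
          rank_one_convex (fun F : 'M[R]_n =>
            Psi (frobenius_sq (devmx (logmx (sqrtmx (F *m F^T)))))
            + Wvol (\det F))].
Proof.
case: n hn => [|[|[|m]]]// _ [Psi [Wvol [[dPsi _ _] _ Psi0 roc]]].
have Psi_lt : forall x z, 0 < x -> x < z -> Psi x < Psi z.
  apply: increasing_of_even_convex => // [r r0|].
    exact: (@rank_one_convex_even_convex R m.+1 Psi Wvol).
  by apply: dPsi; rewrite /= in_itv/= lexx.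
have [b [d [mu [mu_gt ends mid]]]] := @pivot_exists R.
pose L : R := ln 2.
have L0 : 0 < L by rewrite ln_gt0// ltr1n.
have mu0 : 0 < mu by apply: lt_trans mu_gt; rewrite exprn_gt0.
pose Y : R := ln mu.
have LY : 14 * L < Y.
  by rewrite /L /Y mulr_natl -lnXn// ltr_ln ?posrE ?exprn_gt0.
have Y0 : 0 < Y by lra.
(* [16 * L + Y] exceeds the logarithms of all singular values of the [3 x 3]
   block at the three points considered. *)
pose w (j : 'I_m) : R := 16 * L + Y + j%:R.
have wI : injective w.
  by move=> i j /addrI/eqP; rewrite eqr_nat => /eqP/val_inj.
have w_ge j : 16 * L + Y <= w j by rewrite /w lerDl.
have e2 k : expR (k%:R / 2 * L) ^+ 2 = 2 ^+ k.
  rewrite -expRM_natr (_ : _ * 2%:R = k%:R * L); last by field.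
  by rewrite expRM_natl lnK// posrE.
have ord3 (i : 'I_3) : [\/ i = 0, i = 1 | i = 2].
  case: i => [[|[|[|//]]] i]; [apply: Or31|apply: Or32|apply: Or33];
    exact: val_inj.
have inj3 (v : 'I_3 -> R) :
    v 0 != v 1 -> v 0 != v 2 -> v 1 != v 2 -> injective v.
  move=> v01 v02 v12 i j /eqP.
  by case: (ord3 i) => ->; case: (ord3 j) => ->//;
    rewrite ?(negPf v01) ?(negPf v02) ?(negPf v12)//
      eq_sym ?(negPf v01) ?(negPf v02) ?(negPf v12).
(* The logarithms of the singular values at [t = 0] and at [t = b * d / 2]. *)
pose v (i : 'I_3) : R := nth 0 [:: 7 / 2 * L; 9 / 2 * L; - (16 / 2 * L)] i.
pose u (i : 'I_3) : R := nth 0 [:: Y / 2; 0; - (Y / 2)] i.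
have sumv : \sum_i v i ^+ 2 = 193 / 2 * L ^+ 2.
  by rewrite !big_ord_recl big_ord0 /v /=; field.
have sumu : \sum_i u i ^+ 2 = Y ^+ 2 / 2.
  by rewrite !big_ord_recl big_ord0 /u /=; field.
have evv i : expR (v i) ^+ 2 \in [:: 2 ^+ 7; 2 ^+ 9; (2 ^+ 16)^-1].
  rewrite !inE; case: (ord3 i) => ->; rewrite /v /=.
  - by rewrite (e2 7) eqxx.
  - by rewrite (e2 9) eqxx !orbT.
  - by rewrite expRN exprVn (e2 16) eqxx !orbT.
have evu i : expR (u i) ^+ 2 \in [:: mu; 1; mu^-1].
  have Y2 : expR (Y / 2) ^+ 2 = mu.
    by rewrite -expRM_natr mulfVK ?pnatr_eq0// lnK// posrE.
  rewrite !inE; case: (ord3 i) => ->; rewrite /u /=.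
  - by rewrite Y2 eqxx.
  - by rewrite expR0 expr1n eqxx orbT.
  - by rewrite expRN exprVn Y2 eqxx !orbT.
have vI : injective v by apply: inj3; rewrite /v /=; apply/eqP; lra.
have vNI : injective (fun i => - v i) by move=> i j /oppr_inj/vI.
have uI : injective u by apply: inj3; rewrite /u /= gt_eqF//; lra.
have v_lt i : v i < 16 * L + Y by case: (ord3 i) => ->; rewrite /v /=; lra.
have vN_lt i : - v i < 16 * L + Y by case: (ord3 i) => ->; rewrite /v /=; lra.
have u_lt i : u i < 16 * L + Y by case: (ord3 i) => ->; rewrite /u /=; lra.
have v0 : \sum_i v i = 0 by rewrite !big_ord_recl big_ord0 /v /=; field.
have u0 : \sum_i u i = 0 by rewrite !big_ord_recl big_ord0 /u /=; field.
have VU : 193 / 2 * L ^+ 2 < Y ^+ 2 / 2.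
  have : (14 * L) ^+ 2 < Y ^+ 2 by rewrite ltrXn2r ?nnegrE ?mulr_ge0// ltW.
  by rewrite exprMn; have := sqr_ge0 L; lra.
pose h t := Psi (hencky_sq (pad w (pivot b d t))).
have hE t (z : 'I_3 -> R) : injective z -> (forall i, z i < 16 * L + Y) ->
    \sum_i z i = 0 ->
    (forall i, eigenvalue (pivot b d t *m (pivot b d t)^T) (expR (z i) ^+ 2)) ->
    h t = Psi (\sum_i z i ^+ 2 + pad_sq (k := 3) w).
  move=> zI z_lt z0 ez; rewrite /h (hencky_sq_pad (v := z))// => i j.
  by rewrite lt_eqF// (lt_le_trans (z_lt i)).
have h0 : h 0 = Psi (193 / 2 * L ^+ 2 + pad_sq (k := 3) w).
  by rewrite -sumv; apply: hE => // i; exact: ends.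
have hT : h (b * d) = Psi (193 / 2 * L ^+ 2 + pad_sq (k := 3) w).
  rewrite -sumv (eq_bigr (fun i => (- v i) ^+ 2)); last first.
    by move=> i _; rewrite sqrrN.
  apply: hE => // [|i]; first by rewrite sumrN v0 oppr0.
  rewrite expRN exprVn -[b * d]subr0 eigenvalue_pivotV ?ends//.
  by rewrite expf_neq0// gt_eqF// expR_gt0.
have hM : h (b * d / 2) = Psi (Y ^+ 2 / 2 + pad_sq (k := 3) w).
  by rewrite -sumu; apply: hE => // i; exact: mid.
have : h (b * d / 2) <= 2^-1 * h 0 + (1 - 2^-1) * h (b * d).
  rewrite (_ : b * d / 2 = 2^-1 * 0 + (1 - 2^-1) * (b * d)); last by field.
  apply: (@rank_one_convex_pad R 3 m Psi Wvol w _ _ _ roc _ 0 (b * d) 2^-1).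
  - by move=> t; exact: (det_pivot b d t).
  - by rewrite invr_ge0.
  - by rewrite invf_le1// ler1n.
rewrite h0 hT hM -mulrDl (_ : 2^-1 + _ = 1); last by field.
rewrite mul1r leNgt Psi_lt//.
  rewrite ltr_pwDl ?pad_sq_ge0//.
  by rewrite mulr_gt0 ?exprn_gt0.
by rewrite ltrD2r.
Qed.
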